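(* Let $(X,d)$ be a countably generated Lorentzian metric space, and let $\tau:X\to\mathbb{R}$ be a time function. Let $a,b\in\mathbb{R}$ with $a<b$, and let $Q$ be a dense subset of $[a,b]$ such that $a,b\in Q$. Let $\zeta:Q\to X$ be such that - $\tau(\zeta(t))=t$ for all $t\in Q$; - $\zeta(t)\le\zeta(t')$ whenever $t,t'\in Q$, $a\le t<t'\le b$. Then $\zeta$ extends to an isocausal curve $\overline{\zeta}:[a,b]\to X$ parametrised by $\tau$, i.e. $\tau(\overline{\zeta}(s))=s$ for all $s\in[a,b]$. Moreover, if $d(\zeta(t),\zeta(t'))+d(\zeta(t'),\zeta(t''))=d(\zeta(t),\zeta(t''))$ for all $t,t',t''\in Q$ with $t<t'<t''$, then $\overline{\zeta}$ is maximal.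
   Context: Let $X$ be a set and $d:X\times X\to[0,+\infty)$ a function. Notation: $x\ll y$ iff $d(x,y)>0$; $I^+(x)=\{y: x\ll y\}$, $I^-(x)=\{y: y\ll x\}$; for $A\subset X$, $I^\pm(A)=\bigcup_{p\in A}I^\pm(p)$ and $I(A)=I^+(A)\cap I^-(A)$; $I(p,q):=I(\{p,q\})$. For $\epsilon>0$, $I_\epsilon=\{(x,y): d(x,y)\ge\epsilon\}$. $(X,d)$ is a Lorentzian metric space if: (i) $d(x,z)\ge d(x,y)+d(y,z)$ whenever $d(x,y)>0$ and $d(y,z)>0$; (ii) there is a topology $T$ on $X$ such that $d$ is continuous in the product topology and, for every $x,y\in X$ and $\epsilon>0$, the set $I_\epsilon\cap(\overline{I(x,y)}\times\overline{I(x,y)})$ is compact; (iii) for all $x\ne y$ there is $z\in X$ with $d(x,z)\ne d(y,z)$ or $d(z,x)\ne d(z,y)$. It is countably generated if there is a countable $\mathscr{G}\subset X$ with $X=I(\mathscr{G})$; then the topology in (ii) is unique and $X$ is endowed with it. Causal relation: $x\le y$ means $d(p,y)\ge d(p,x)$ and $d(x,p)\ge d(y,p)$ for all $p\in X$; $x<y$ means $x\le y$ and $x\ne y$. A time function is a continuous $\tau:X\to\mathbb{R}$ with $\tau(x)<\tau(y)$ whenever $x<y$. A continuous curve $\sigma:[a,b]\to X$ is isocausal if $a\le s<t\le b$ implies $\sigma(s)<\sigma(t)$; it is maximal if it is isocausal and $d(\sigma(t),\sigma(t'))+d(\sigma(t'),\sigma(t''))=d(\sigma(t),\sigma(t''))$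 for all $a\le t<t'<t''\le b$. *)

(* Defs.v *)
From HB Require Import structures.
From mathcomp Require Import all_boot all_order all_algebra.
From mathcomp Require Import all_classical all_reals all_analysis.

Set Implicit Arguments.
Unset Strict Implicit.
Unset Printing Implicit Defensive.

Import Order.TTheory GRing.Theory Num.Theory.
Import numFieldNormedType.Exports.

Local Open Scope classical_set_scope.
Local Open Scope ring_scope.

Section LorentzianMetricSpace.
Context {R : realType} {X : topologicalType} (d : X -> X -> R).

Definition chron (x y : X) : Prop := 0 < d x y.

Definition Iplus (A : set X) : set X := \bigcup_(p in A) [set y | chron p y].

Definition Iminus (A : set X) : set X := \bigcup_(p in A) [set y | chron y p].

(* For [A := [set p; q]] this is I(p,q). *)
Definition diamond (A : set X) : set X := Iplus A `&` Iminus A.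

Definition Ieps (e : R) : set (X * X) := [set p | e <= d p.1 p.2].

(* The topology is the one carried by [X]: a set with a function d is a
   Lorentzian metric space when it can be given a topology making this record
   inhabited.  In the countably generated case that topology is unique. *)
Record lorentzian_metric : Prop := LorentzianMetric {
  lorentzian_ge0 : forall x y, 0 <= d x y ;
  lorentzian_reverse_triangle : forall x y z,
    0 < d x y -> 0 < d y z -> d x y + d y z <= d x z ;
  lorentzian_continuous : continuous (fun p : X * X => d p.1 p.2) ;
  lorentzian_compact : forall (x y : X) (e : R), 0 < e ->
    compact (Ieps e `&` (closure (diamond [set x; y]) `*`
                         closure (diamond [set x; y]))) ;
  lorentzian_distinguishing : forall x y, x <> y ->
    exists z, d x z <> d y z \/ d z x <> d z y }.

Definition countably_generated : Prop :=
  exists2 G : set X, countable G & [set: X] = diamond G.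

Definition causal (x y : X) : Prop :=
  forall p, d p x <= d p y /\ d y p <= d x p.

Definition strict_causal (x y : X) : Prop := causal x y /\ x <> y.

Definition time_function (tau : X -> R) : Prop :=
  continuous tau /\ forall x y, strict_causal x y -> tau x < tau y.

(* A curve on [a,b] is a total map of which only the values on [a,b] matter. *)
Definition isocausal (a b : R) (sigma : R -> X) : Prop :=
  {within `[a, b], continuous sigma} /\
  forall s t, a <= s -> s < t -> t <= b -> strict_causal (sigma s) (sigma t).

Definition maximal (a b : R) (sigma : R -> X) : Prop :=
  isocausal a b sigma /\
  forall t t' t'', a <= t -> t < t' -> t' < t'' -> t'' <= b ->
    d (sigma t) (sigma t') + d (sigma t') (sigma t'') = d (sigma t) (sigma t'').

End LorentzianMetricSpace.

(* Main.v *)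
(* Countable generation puts zeta a in some I^+(p) and zeta b in some I^-(q), so
   every z between zeta a and zeta b satisfies d p z >= d p (zeta a) > 0, and the
   compactness axiom confines zeta to a compact set C.  Since the causal relation
   is closed, a cluster point of zeta at s lies in C, has time s, and is causally
   related to every zeta t on the correct side.  Any choice of such points that
   agrees with zeta on Q is isocausal by density of Q, and it is automatically
   continuous: a cluster point at s of the extended curve is causally related to
   its value at s and has the same time, hence equals it.  Additivity of d passes
   from Q to [a,b] by continuity, one variable at a time. *)
Require Import Defs.
From HB Require Import structures.
From mathcomp Require Import all_boot all_order all_algebra.
From mathcomp Require Import all_classical all_reals all_analysis.

Set Implicit Arguments.
Unset Strict Implicit.
Unset Printing Implicit Defensive.

Import Order.TTheory GRing.Theory Num.Theory.
Import numFieldNormedType.Exports.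

Local Open Scope classical_set_scope.
Local Open Scope ring_scope.

(** * Cluster points of filters and closed conditions *)

Lemma compact_unique_cluster_cvg {T : topologicalType} (F : set_system T)
    (C : set T) (x : T) : ProperFilter F -> compact C -> F C ->
  (forall y, C y -> cluster F y -> y = x) -> F --> x.
Proof.
move=> FF cC FC uniq U Ux; apply: contrapT => nFU.
(* If a neighbourhood [U] of [x] were not in [F], the trace of [F] on its complement would be
   proper. By compactness this trace clusters in [C]; such a point also clusters [F], so it is [x],
   although [U] misses the trace. *)
have PG : ProperFilter (within (~` U) F).
  apply: Build_ProperFilter_ex => B FB; apply: contrapT => B0.
  apply: nFU; apply: (filterS (F := F)) FB => z Bz; apply: contrapT => nUz.
  by apply: B0; exists z; exact: Bz.
have [|y [Cy cly]] := cC _ PG; first by rewrite /within /=; apply: filterS FC.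
have yx : y = x.
  apply: uniq => // A B FA yB; apply: cly => //.
  by rewrite /within /=; apply: filterS FA.
have [||z []] := cly (~` U) U; last by [].
- by rewrite /within /=; apply: filterE.
- by rewrite yx.
Qed.

Lemma image_within {T U : Type} (F : set_system T) (A B : set T) (f : T -> U)
    (P : set U) {FF : Filter F} : F B -> (forall t, A t -> B t -> P (f t)) ->
  (f @ within A F) P.
Proof.
by move=> FB ABP; apply: (filterS (F := F)) FB => t Bt At; exact: ABP.
Qed.

Lemma cluster_closed {T : topologicalType} (F : set_system T) (A : set T)
    (x : T) : closed A -> F A -> cluster F x -> A x.
Proof. by move=> cA FA clx; apply: cA => B; exact: clx. Qed.

(** Points of [Q] close enough to [s] lie in [O], and continuity brings their values to [f s]. The
    open set [O] accommodates conditions known only for parameters subject to strict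
    inequalities. *)
Lemma closed_dense_within {R : realType} {Y : topologicalType} (A Q O : set R)
    (f : R -> Y) (P : set Y) (s : R) :
  {within A, continuous f} -> Q `<=` A -> A `<=` closure Q -> open O ->
  closed P -> (forall t, Q t -> O t -> P (f t)) -> A s -> O s -> P (f s).
Proof.
move=> /subspace_continuousP cf QA Qd oO cP QP As Os; apply: cP => B fB.
have [|t [Qt [ft Ot]]] := Qd _ As ([set t | A t -> B (f t)] `&` O).
  by apply: filterI; [exact: (cf _ As _ fB) | exact: open_nbhs_nbhs].
by exists (f t); split; [exact: QP | apply: ft; exact: QA].
Qed.

Lemma closed_sum_eq {R : realType} {X : topologicalType} (f g h : X -> R) :
  continuous f -> continuous g -> continuous h ->
  closed [set x | f x + g x = h x].
Proof.
move=> cf cg ch.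
rewrite (_ : [set x | _] = (fun x => f x + g x - h x) @^-1` [set r | r = 0]).
  apply: preimage_closed; last exact: closed_eq.
  move=> x _; apply: cvgB; last exact: ch.
  by apply: cvgD; [exact: cf | exact: cg].
apply/seteqP; split=> x /=.
  by move=> ->; rewrite subrr.
by move/eqP; rewrite subr_eq0 => /eqP.
Qed.

(** * Closedness of the causal relation, compactness, and the time function *)

Section Causality.
Context {R : realType} {X : topologicalType} (d : X -> X -> R).

Lemma causal_trans (x y z : X) : causal d x y -> causal d y z -> causal d x z.
Proof.
move=> xy yz p; have [? ?] := xy p; have [? ?] := yz p.
by split; [exact: le_trans (d p y) _ _ _ _ | exact: le_trans (d y p) _ _ _ _].
Qed.

Lemma causal_refl (x : X) : causal d x x.
Proof. by []. Qed.

Context (dL : lorentzian_metric d).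

Lemma continuous_dist_left (y : X) : continuous (d^~ y).
Proof.
move=> x; apply: (@continuous_comp _ _ _ (fun x => (x, y)) (fun p => d p.1 p.2)).
  by apply: cvg_pair; [exact: cvg_id | exact: cvg_cst].
exact: lorentzian_continuous.
Qed.

Lemma continuous_dist_right (x : X) : continuous (d x).
Proof.
move=> y; apply: (@continuous_comp _ _ _ (pair x) (fun p => d p.1 p.2)).
  by apply: cvg_pair; [exact: cvg_cst | exact: cvg_id].
exact: lorentzian_continuous.
Qed.

Lemma closed_causal_future (x : X) : closed (causal d x).
Proof.
rewrite (_ : causal d x = \bigcap_p
  (d p @^-1` [set r | d p x <= r] `&` d^~ p @^-1` [set r | r <= d x p])).
  apply: closed_bigI => p _; apply: closedI; apply: preimage_closed.
  - by move=> ? _; exact: continuous_dist_right.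
  - exact: closed_ge.
  - by move=> ? _; exact: continuous_dist_left.
  - exact: closed_le.
by apply/seteqP; split=> [y xy p _|y xy p]; [exact: xy | exact: (xy p I)].
Qed.

Lemma closed_causal_past (y : X) : closed ((causal d)^~ y).
Proof.
rewrite (_ : (causal d)^~ y = \bigcap_p
  (d p @^-1` [set r | r <= d p y] `&` d^~ p @^-1` [set r | d y p <= r])).
  apply: closed_bigI => p _; apply: closedI; apply: preimage_closed.
  - by move=> ? _; exact: continuous_dist_right.
  - exact: closed_le.
  - by move=> ? _; exact: continuous_dist_left.
  - exact: closed_ge.
by apply/seteqP; split=> [x xy p _|x xy p]; [exact: xy | exact: (xy p I)].
Qed.

Lemma causal_interval_sub_compact (x y : X) : countably_generated d ->
  exists2 C : set X, compact C & forall z, causal d x z -> causal d z y -> C z.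
Proof.
move=> [G _ GX].
have [[p _ px] _] : diamond d G x by rewrite -GX.
have [_ [q _ yq]] : diamond d G y by rewrite -GX.
(* The compactness axiom concerns pairs, so [z] is recovered as the second component of [(p, z)].
   The extra point [p'] before [p] puts [p] itself in I(p',q), and [d p x] is a positive lower bound
   for [d p z]. *)
have [[p' _ p'p] _] : diamond d G p by rewrite -GX.
rewrite /chron /= in px yq p'p.
exists (snd @` (Ieps d (d p x) `&` (closure (diamond d [set p'; q]) `*`
                                   closure (diamond d [set p'; q])))).
  apply: continuous_compact; last exact: lorentzian_compact.
  by apply: continuous_subspaceT => ?; exact: cvg_snd.
move=> z xz zy.
have pxz : d p x <= d p z by case: (xz p).
have pz : 0 < d p z by exact: lt_le_trans pxz.
have zq : 0 < d z q by apply: lt_le_trans yq _; case: (zy q).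
have pq : 0 < d p q.
  by apply: lt_le_trans (lorentzian_reverse_triangle dL pz zq); exact: addr_gt0.
have p'z : 0 < d p' z.
  by apply: lt_le_trans (lorentzian_reverse_triangle dL p'p pz); exact: addr_gt0.
exists (p, z) => //; split=> //; split; apply: subset_closure;
  by split; [exists p'; [left|] | exists q; [right|]].
Qed.

Context (tau : X -> R) (tauT : time_function d tau).

Lemma causal_eq_tau (x y : X) : causal d x y -> tau x = tau y -> x = y.
Proof.
move=> xy txy; apply: contrapT => nxy.
by have := tauT.2 x y (conj xy nxy); rewrite txy ltxx.
Qed.

(** Along the filter the times tend to [s], while continuity of [tau] makes [tau x] a cluster point
    of them; the line is Hausdorff. *)
Lemma cluster_section (A : set R) (sigma : R -> X) (s : R) (x : X) :
  (forall t, A t -> tau (sigma t) = t) ->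
  cluster (sigma @ within A (nbhs s)) x -> tau x = s.
Proof.
move=> Atau clx; apply/esym/(@norm_hausdorff _ R) => U V sU xV.
have [||z [Uz Vz]] := clx (tau @^-1` U) (tau @^-1` V).
- by apply: filterS sU => t Ut At; rewrite /preimage /= Atau.
- exact: tauT.1.
- by exists (tau z).
Qed.

(* A cluster point x of sigma at s is causally related to sigma s, since the
   causal future and past of sigma s are closed; and tau x = s = tau (sigma s). *)
Lemma causal_section_continuous (A : set R) (C : set X) (sigma : R -> X) :
  compact C -> (forall s, A s -> C (sigma s)) ->
  (forall s, A s -> tau (sigma s) = s) ->
  (forall s t, A s -> A t -> s < t -> causal d (sigma s) (sigma t)) ->
  {within A, continuous sigma}.
Proof.
move=> cC AC Atau Ac; apply/subspace_continuousP => s As.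
have PF : ProperFilter (within A (nbhs s)).
  by apply: within_nbhs_proper; exact: subset_closure.
apply: (compact_unique_cluster_cvg _ cC).
  by apply: (image_within (F := nbhs s) filterT) => t At _; auto.
move=> x _ clx.
have tx := cluster_section Atau clx.
have [||xs|sx] := @cluster_closed _ _
    ((causal d)^~ (sigma s) `|` causal d (sigma s)) _ _ _ clx.
- by apply: closedU; [exact: closed_causal_past | exact: closed_causal_future].
- apply: (image_within (F := nbhs s) filterT) => t At _ /=.
  have [ts|st|->] := ltgtP t s; first by left; exact: Ac.
    by right; exact: Ac.
  by left.
- by apply: causal_eq_tau; rewrite // tx Atau.
- by apply/esym/causal_eq_tau; rewrite // tx Atau.
Qed.

(** * Candidate values for the extension *)

Section Extension.
Context (Q : set R) (C : set X) (zeta : R -> X).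
Context (cC : compact C) (QC : forall t, Q t -> C (zeta t)).
Context (Qtau : forall t, Q t -> tau (zeta t) = t).
Context (Qcausal :
  forall t t', Q t -> Q t' -> t < t' -> causal d (zeta t) (zeta t')).

(** Membership in [C] is recorded because continuity of the extension needs all its values in one
    compact set. *)
Definition interpolants (s : R) : set X :=
  [set x | [/\ C x, tau x = s,
    forall t, Q t -> t < s -> causal d (zeta t) x &
    forall t, Q t -> s < t -> causal d x (zeta t)]].

Lemma interpolants_nonempty (s : R) : closure Q s -> interpolants s !=set0.
Proof.
move=> Qs.
have PF : ProperFilter (within Q (nbhs s)) by exact: within_nbhs_proper.
have [|x [Cx clx]] := cC (F := zeta @ within Q (nbhs s)).
  by apply: (image_within (F := nbhs s) filterT) => t At _; auto.
exists x; split=> //; first exact: cluster_section clx.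
(* Parameters close to [s] all exceed [t], so [zeta] is eventually in the closed causal future of
   [zeta t]; the case [s < t] is symmetric. *)
- move=> t Qt ts; apply: (cluster_closed _ _ clx).
    exact: closed_causal_future.
  by apply: (image_within (lt_nbhsr ts)) => t' Qt' tt'; exact: Qcausal.
- move=> t Qt st; apply: (cluster_closed (A := (causal d)^~ (zeta t)) _ _ clx).
    exact: closed_causal_past.
  by apply: (image_within (lt_nbhsl st)) => t' Qt' tt'; exact: Qcausal.
Qed.

Lemma mem_interpolants (t : R) : Q t -> interpolants t (zeta t).
Proof.
move=> Qt; split=> [||t' Qt' tt'|t' Qt' tt'];
  by [exact: QC | exact: Qtau | exact: Qcausal].
Qed.

End Extension.
End Causality.

Theorem lemma5p5 (R : realType) (X : topologicalType) (d : X -> X -> R)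
  (dL : lorentzian_metric d) (dG : countably_generated d)
  (tau : X -> R) (tauT : time_function d tau)
  (a b : R) (ab : a < b)
  (Q : set R) (Qab : Q `<=` `[a, b]) (Qdense : `[a, b] `<=` closure Q)
  (Qa : Q a) (Qb : Q b)
  (zeta : R -> X)
  (zeta_tau : forall t, Q t -> tau (zeta t) = t)
  (zeta_causal : forall t t', Q t -> Q t' -> t < t' ->
     causal d (zeta t) (zeta t')) :
  exists zbar : R -> X,
    [/\ forall t, Q t -> zbar t = zeta t,
        isocausal d a b zbar,
        forall s, a <= s -> s <= b -> tau (zbar s) = s
      & (forall t t' t'', Q t -> Q t' -> Q t'' -> t < t' -> t' < t'' ->
           d (zeta t) (zeta t') + d (zeta t') (zeta t'')
             = d (zeta t) (zeta t'')) ->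
        maximal d a b zbar].
Proof.
have [C cC QC] : exists2 C : set X, compact C & forall t, Q t -> C (zeta t).
  have [C cC zC] := causal_interval_sub_compact dL (zeta a) (zeta b) dG.
  exists C => // t Qt; have := Qab _ Qt; rewrite /= in_itv /= => /andP[].
  rewrite !le_eqVlt => at_ tb; apply: zC.
    by case/orP: at_ => [/eqP <-|at_]; [exact: causal_refl|exact: zeta_causal].
  by case/orP: tb => [/eqP ->|tb]; [exact: causal_refl|exact: zeta_causal].
(* On [Q] the value must be [zeta s], itself an interpolant; elsewhere in the closure any
   interpolant will do. Outside the closure [zeta s] is a mere default. *)
have /choice[zbar zbarP] : forall s, exists x,
    (closure Q s -> interpolants d tau Q C zeta s x) /\ (Q s -> x = zeta s).
  move=> s; have [Qs|nQs] := pselect (Q s).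
    by exists (zeta s); split=> // _; exact: mem_interpolants.
  have [cQs|ncQs] := pselect (closure Q s); last by exists (zeta s).
  by have [x] := interpolants_nonempty dL tauT cC QC zeta_tau zeta_causal cQs;
    exists x.
have zbarI s : [set` `[a, b]] s -> interpolants d tau Q C zeta s (zbar s).
  by move=> /Qdense; exact: (zbarP s).1.
have zbarQ t : Q t -> zbar t = zeta t := (zbarP t).2.
have zbar_tau s : [set` `[a, b]] s -> tau (zbar s) = s by move=> /zbarI[].
have zbar_causal s t : [set` `[a, b]] s -> [set` `[a, b]] t -> s < t ->
    causal d (zbar s) (zbar t).
  move=> As At st.
  (* The values at [s] and [t] were chosen independently; a point of [Q] strictly between them,
     found near the midpoint, links them by transitivity. *)
  have [r [Qr]] : Q `&` [set` `]s, t[] !=set0.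
    move: As At; rewrite /= !in_itv /= => /andP[as_ _] /andP[_ tb].
    apply: (Qdense ((s + t) / 2)).
      by rewrite /= in_itv /= (le_trans as_) ?(le_trans _ tb) ?midf_le ?ltW.
    apply: open_nbhs_nbhs; split; first exact: interval_open.
    by rewrite /= in_itv /= !midf_lt.
  rewrite /= in_itv /= => /andP[sr rt].
  have [_ _ _ /(_ r Qr sr) sc] := zbarI s As.
  have [_ _ /(_ r Qr rt) tc _] := zbarI t At.
  exact: causal_trans sc tc.
have zbar_cont : {within `[a, b], continuous zbar}.
  apply: (causal_section_continuous dL tauT cC) => // s As.
  by have [] := zbarI s As.
have zbar_iso : isocausal d a b zbar.
  split=> // s t as_ st tb.
  have As : [set` `[a, b]] s by rewrite /= in_itv /= as_ (le_trans (ltW st)).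
  have At : [set` `[a, b]] t by rewrite /= in_itv /= tb (le_trans as_ (ltW st)).
  split; first exact: zbar_causal.
  by move=> /(congr1 tau); rewrite !zbar_tau // => /eqP; rewrite lt_eqF.
exists zbar; split=> //.
  by move=> s as_ sb; apply: zbar_tau; rewrite /= in_itv /= as_.
move=> zeta_add; split=> //.
pose add x y z := d x y + d y z = d x z.
have dense_ext (O : set R) (P : set X) s : open O -> closed P ->
    (forall t, Q t -> O t -> P (zeta t)) -> [set` `[a, b]] s -> O s ->
    P (zbar s).
  move=> oO cP QP; apply: (closed_dense_within zbar_cont Qab Qdense oO cP).
  by move=> t Qt; rewrite zbarQ //; exact: QP.
(* The parameters leave [Q] in the order first, middle, last, the other two being held fixed. The
   open sets [r < t'], [t < r < t''] and [t' < r] preserve the strict order under which additivity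
   is already known. *)
have add1 t t' t'' : [set` `[a, b]] t -> Q t' -> Q t'' -> t < t' -> t' < t'' ->
    add (zbar t) (zeta t') (zeta t'').
  move=> At Qt' Qt'' tt' tt''.
  apply: (dense_ext [set r | r < t'] [set x | add x (zeta t') (zeta t'')]) => //.
  - by apply: closed_sum_eq; [exact: continuous_dist_left|exact: cst_continuous|
      exact: continuous_dist_left].
  - by move=> r Qr rt; exact: zeta_add.
have add2 t t' t'' : [set` `[a, b]] t -> [set` `[a, b]] t' -> Q t'' ->
    t < t' -> t' < t'' -> add (zbar t) (zbar t') (zeta t'').
  move=> At At' Qt'' tt' tt''.
  apply: (dense_ext [set` `]t, t''[] [set x | add (zbar t) x (zeta t'')]) => //.
  - by apply: closed_sum_eq; [exact: continuous_dist_right|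
      exact: continuous_dist_left|exact: cst_continuous].
  - by move=> r Qr; rewrite /= in_itv /= => /andP[tr rt]; exact: add1.
  - by rewrite /= in_itv /= tt'.
move=> t t' t'' at_ tt' tt'' tb.
have At' : [set` `[a, b]] t'.
  by rewrite /= in_itv /= (le_trans at_ (ltW tt')) (le_trans (ltW tt'')).
apply: (dense_ext [set r | t' < r] [set x | add (zbar t) (zbar t') x]) => //.
- by apply: closed_sum_eq; [exact: cst_continuous|exact: continuous_dist_right|
    exact: continuous_dist_right].
- move=> r Qr tr; apply: add2 => //.
  by rewrite /= in_itv /= at_ (le_trans (ltW (lt_trans tt' tt''))).
- by rewrite /= in_itv /= tb (le_trans at_ (ltW (lt_trans tt' tt''))).
Qed.
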